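(* Assume $\mathfrak r=\mathfrak d=\mathfrak c$. Then there exists a filter $\mathcal G$ on $\omega$ such that: (1) both $\mathcal G$ and $\mathcal G^+$ are Menger; (2) for every finite-to-one surjection $\phi:\omega\to\omega$ there exists $X\subset\omega$ such that $\phi^{-1}[X]\in\mathcal G^+$ and $\phi^{-1}[\omega\setminus X]\in\mathcal G^+$.
   Context: $\mathfrak r$ (reaping number), $\mathfrak d$ (dominating number) and $\mathfrak c=2^{\aleph_0}$ are the usual cardinal characteristics of the continuum. $\mathcal P(\omega)$ is identified with the Cantor space $2^\omega$ via characteristic functions, and subsets of $\mathcal P(\omega)$ carry the subspace topology. Filters on $\omega$ are free: $\mathcal G\subset[\omega]^\omega$ (all members are infinite), $\mathcal G$ is closed under finite intersections and supersets, and contains all cofinite sets. For $\mathcal G\subset\mathcal P(\omega)$, $\mathcal G^+=\{X\subset\omega:\forall F\in\mathcal G\ (X\cap F\neq\emptyset)\}$. A topological space $X$ is Menger if for every sequence $\langle \mathcal U_n:n\in\omega\rangle$ of open covers of $X$ there are finite $\mathcal V_n\subset\mathcal U_n$ such that $\{\bigcup\mathcal V_n:n\in\omega\}$ covers $X$. *)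

(* Defs.v *)
From mathcomp Require Import all_boot.
From mathcomp Require Import all_classical topology cantor.

Set Implicit Arguments.
Unset Strict Implicit.
Unset Printing Implicit Defensive.

Local Open Scope classical_set_scope.
Local Open Scope card_scope.

(** [min_card P C] says that min {|A| : P A} = |C|; cardinals are represented
    by sets up to equipotence [#=], ordered by [#<=]. *)
Definition min_card {T U : Type} (P : set (set T)) (C : set U) : Prop :=
  (exists2 A, P A & A #= C) /\ (forall A, P A -> C #<= A).

(** A set of cardinality 2^aleph_0. *)
Definition continuum : set (nat -> bool) := setT.

Definition splits (X A : set nat) : Prop :=
  infinite_set (A `&` X) /\ infinite_set (A `\` X).

Definition reaping (R : set (set nat)) : Prop :=
  R `<=` [set A | infinite_set A] /\ ~ (exists X, forall A, R A -> splits X A).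

Definition eventually_le (f g : nat -> nat) : Prop :=
  \forall n \near \oo, (f n <= g n)%N.

Definition dominating (D : set (nat -> nat)) : Prop :=
  forall f, exists2 g, D g & eventually_le f g.

Definition open_cover {T : topologicalType} (U : set (set T)) : Prop :=
  U `<=` open /\ \bigcup_(O in U) O = setT.

Definition menger (T : topologicalType) : Prop :=
  forall U : nat -> set (set T), (forall n, open_cover (U n)) ->
  exists V : nat -> set (set T),
    (forall n, finite_set (V n) /\ V n `<=` U n) /\
    \bigcup_n \bigcup_(O in V n) O = setT.

(** The identification of the power set of nat with the Cantor space. *)
Definition char_fun (A : set nat) : cantor_space := fun n => `[< A n >].

(** [set_type] carries the subspace topology of
    [cantor_space], as a space in its own right (unlike [subspace]). *)
Definition menger_family (F : set (set nat)) : Prop :=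
  menger (set_type (char_fun @` F)).

Definition free_filter (G : set_system nat) : Prop :=
  [/\ Filter G, G `<=` [set A | infinite_set A] & [set A | cofinite_set A] `<=` G].

Definition positive (G : set_system nat) : set_system nat :=
  [set X | forall F, G F -> X `&` F !=set0].

Definition finite_to_one (phi : nat -> nat) : Prop :=
  forall n, finite_set (phi @^-1` [set n]).

(* Main.v *)
Require Import Defs.
From mathcomp Require Import all_boot.
From mathcomp Require Import finmap.
From mathcomp Require wochoice.
From mathcomp Require Import all_classical topology cantor.

(** Points of the Cantor space stand for subsets of [nat].  The filter is
    generated by compact sets [K i], and compact sets [L i] of sets are promised
    to be positive, for [i] in a well-ordered set of size continuum with smaller
    initial segments; stage [i] deals with one cover or one finite-to-one map.
    By compactness, an open cover of an upward closed family may be replaced by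
    a set [A n] of finite sets such that each member includes one of them.

    If some set including no element of [A n] can be added to the filter (resp.
    promised positive), adding it means that [A] no longer has to be dealt with.
    Otherwise compactness bounds, for each of the fewer than continuum many
    combinations of earlier compact sets, the elements of [A n] that are needed;
    since d = c, a single [f] exceeds each of these bounds infinitely often.
    The compact set of all [Y] meeting every element of [A n] below [f n], for
    all [n], is then promised positive (resp. added to the filter), so that no
    member of the filter (resp. no positive set) avoids all these elements.

    For a finite-to-one [phi], d = c yields an interval partition such that the
    [phi]-images of all members of an earlier compact set meet infinitely many
    common intervals; r = c then splits all these sets of intervals at once, and
    the two preimages of the resulting splitting are promised positive. *)

Set Implicit Arguments.
Unset Strict Implicit.
Unset Printing Implicit Defensive.

Local Open Scope classical_set_scope.
Local Open Scope card_scope.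

(** * Small initial segments *)

Lemma card_leW {T U : Type} {A : set T} {B : set U} (f : T -> U) :
  {homo f : x / A x >-> B x} -> {in A &, injective f} -> A #<= B.
Proof.
move=> fAB finj; have [g] : $|{injfun A >-> B}| by apply/injfunPex; exists f.
exact: inj_card_le g.
Qed.

Lemma card_le_ex {T : Type} {U : pointedType} {A : set T} {B : set U} :
  A #<= B -> exists2 f : T -> U, {homo f : x / A x >-> B x} &
    {in A &, injective f}.
Proof.
by move=> /pcard_leP/injfunPex[f fAB finj]; exists f.
Qed.

Lemma card_le_setX {T T' : Type} {U U' : pointedType}
    (A : set T) (A' : set T') (B : set U) (B' : set U') :
  A #<= B -> A' #<= B' -> A `*` A' #<= B `*` B'.
Proof.
move=> /card_le_ex[f fAB finj] /card_le_ex[f' fAB' finj'].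
apply: (@card_leW _ _ _ _ (fun p => (f p.1, f' p.2))).
  by move=> [x y] [/= Ax Ay]; split => /=; [exact: fAB|exact: fAB'].
move=> [x y] [x' y']; rewrite !inE => -[/= Ax Ay] [/= Ax' Ay'] [].
move=> fxx' fyy'; congr pair; [apply: finj|apply: finj'] => //; exact: mem_set.
Qed.

Record well_ordered {T : Type} (lt : T -> T -> Prop) : Prop := WellOrdered {
  wo_wf : well_founded lt;
  wo_trans : forall x y z, lt x y -> lt y z -> lt x z;
  wo_total : forall x y, [\/ lt x y, x = y | lt y x] }.

Lemma well_ordered_exists (T : choiceType) :
  exists lt : T -> T -> Prop, well_ordered lt.
Proof.
have [R Rwo] := wochoice.well_ordering_principle T.
have RwoT : wochoice.wo_chain R predT by apply: wochoice.withinW.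
have Rtot : total R by move=> x y; apply: (wochoice.wo_chainW RwoT).
have Ranti : antisymmetric R.
  by move=> x y; apply: (wochoice.wo_chain_antisymmetric RwoT).
have min_ex (A : set T) : A !=set0 -> exists2 z, A z & forall y, A y -> R z y.
  move=> [x Ax]; have [|z [[zA zmin] _]] := Rwo (fun x => x \in A).
    by exists x; rewrite unfold_in; apply/mem_set.
  exists z; first by move: zA; rewrite unfold_in => /set_mem.
  by move=> y Ay; apply: zmin; rewrite unfold_in; apply/mem_set.
exists (fun x y => R x y /\ x <> y); split.
- move=> x; apply: contrapT => xNacc.
  have [|z zNacc zmin] := min_ex [set x | ~ Acc (fun x y => R x y /\ x <> y) x].
    by exists x.
  apply: zNacc; constructor => y [Ryz yz]; apply: contrapT => /zmin Rzy.
  by apply: yz; apply: Ranti; rewrite Ryz.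
- move=> x y z [Rxy xy] [Ryz yz].
  (* Transitivity is read off from the least element of the set of [x], [y], [z]: antisymmetry
     excludes [y] and [z]. *)
  have Rxz : R x z.
    have [|w] := min_ex [set x; y; z]; first by exists x; left; left.
    move=> [[|]|] -> wmin.
    + by apply: wmin; right.
    + by case: xy; apply: Ranti; rewrite Rxy wmin//; left; left.
    + by case: yz; apply: Ranti; rewrite Ryz wmin//; left; right.
  split=> // xz; apply: yz; apply: Ranti; rewrite Ryz -xz //.
- move=> x y; have [->|/eqP xy] := eqVneq x y; first by constructor 2.
  case/orP: (Rtot x y) => Rxy; [constructor 1|constructor 3]; split => //.
  exact: nesym.
Qed.

(** The step [F] receives a total function, masked by [u0] outside the predecessors of [x]; this
    avoids functions with dependent domains later on. *)
Lemma wf_rec {T U : Type} (u0 : U) (lt : T -> T -> Prop) :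
  well_founded lt -> forall F : T -> (T -> U) -> U,
  exists h : T -> U, forall x,
    h x = F x (fun y => if pselect (lt y x) then h y else u0).
Proof.
move=> wf F.
pose G x (g : forall y, lt y x -> U) : U :=
  F x (fun y => if pselect (lt y x) is left l then g y l else u0).
exists (Fix wf (fun _ => U) G) => x.
rewrite Fix_eq /G; first by congr F; apply/funext => y; case: pselect.
move=> {}x f g fg; congr F; apply/funext => y.
by case: pselect.
Qed.

Definition seg {T : Type} (lt : T -> T -> Prop) (i : T) : set T :=
  [set j | lt j i].

Lemma infinite_two {T : Type} (A : set T) :
  infinite_set A -> exists a b, [/\ A a, A b & a <> b].
Proof.
move=> Ainf; have [a Aa] := infinite_setN0 Ainf.
apply: contrapT => H; apply: Ainf; apply: sub_finite_set (finite_set1 a).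
move=> b Ab /=; apply: contrapT => ba; apply: H; exists a, b; split => //.
exact: nesym.
Qed.

(* Gödel's ordering of pairs: by maximum, then lexicographically. *)
Lemma well_ordered_pairs {T : Type} (lt : T -> T -> Prop) :
  well_ordered lt -> exists2 glt : T * T -> T * T -> Prop, well_ordered glt &
    forall p q, glt q p ->
      exists2 m, m = p.1 \/ m = p.2 &
        (lt q.1 m \/ q.1 = m) /\ (lt q.2 m \/ q.2 = m).
Proof.
case=> wf trans total.
pose mx (p : T * T) := if `[< lt p.1 p.2 >] then p.2 else p.1.
have irr x : ~ lt x x.
  by elim: (wf x) => {}x _ IH xx; exact: (IH x).
have mxP p : (mx p = p.1 \/ mx p = p.2) /\
    (lt p.1 (mx p) \/ p.1 = mx p) /\ (lt p.2 (mx p) \/ p.2 = mx p).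
  rewrite /mx; case: asboolP => H; first by split; [right|split; [left|right]].
  by split; [left|split; [right|case: (total p.1 p.2) => // ?; [right|left]]].
pose glt p q := lt (mx p) (mx q) \/ mx p = mx q /\
  (lt p.1 q.1 \/ p.1 = q.1 /\ lt p.2 q.2).
exists glt; last first.
  move=> p q qp; exists (mx p); first by case: (mxP p).
  have [_ [q1 q2]] := mxP q.
  case: qp => [qp|[<- _]] //.
  by split; left; [case: q1 => [h|->]|case: q2 => [h|->]] => //;
    apply: trans qp.
split.
- have acc m : forall p, mx p = m -> Acc glt p.
    elim: (wf m) => {}m _ IHm.
    have acc1 a : forall p, p.1 = a -> mx p = m -> Acc glt p.
      elim: (wf a) => {}a _ IHa.
      have acc2 b : forall p, p.2 = b -> p.1 = a -> mx p = m -> Acc glt p.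
        elim: (wf b) => {}b _ IHb p pb pa pm.
        constructor => q; rewrite /glt pb pa pm.
        case=> [qm|[qm [qa|[qa qb]]]].
        - exact: (IHm _ qm q erefl).
        - exact: (IHa _ qa q erefl qm).
        - exact: (IHb _ qb q erefl qa qm).
      by move=> p; apply: acc2.
    by move=> p; apply: acc1.
  by move=> p; apply: acc.
- move=> p q r; rewrite /glt => -[pq|[pq pq']] [qr|[qr qr']].
  + by left; apply: trans qr.
  + by left; rewrite -qr.
  + by left; rewrite pq.
  + right; split; first by rewrite pq.
    case: pq' qr' => [h|[h h']] [k|[k k']].
    * by left; apply: trans k.
    * by left; rewrite -k.
    * by left; rewrite h.
    * by right; split; [rewrite h|apply: trans k'].
- move=> [a b] [a' b']; rewrite /glt /=.
  case: (total (mx (a, b)) (mx (a', b'))) => H; first by constructor 1; left.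
    case: (total a a') => H1.
    + by constructor 1; right; split => //; left.
    + case: (total b b') => H2.
      * by constructor 1; right; split => //; right.
      * by constructor 2; rewrite H1 H2.
      * by constructor 3; right; split => //; right.
    + by constructor 3; right; split => //; left.
  by constructor 3; left.
Qed.

(* Hessenberg's theorem: the injection sends each pair to the least value not
   taken on smaller pairs in Gödel's ordering. *)
Lemma seg_square {T : pointedType} (lt : T -> T -> Prop) (i : T) :
  well_ordered lt -> infinite_set (seg lt i) ->
  seg lt i `*` seg lt i #<= seg lt i.
Proof.
move=> wo; elim: (wo_wf wo i) => {}i _ IH iinf.
(* Past this case [i] behaves like an initial ordinal: its segment injects into no earlier one. *)
have [[j ji ij]|noj] := pselect (exists2 j, lt j i & seg lt i #<= seg lt j).
  have jinf : infinite_set (seg lt j) by move=> /(card_le_finite ij).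
  apply: card_le_trans (card_le_setX ij ij) _.
  apply: card_le_trans (IH j ji jinf) _.
  by apply: subset_card_le => k /= kj; apply: (wo_trans wo) ji.
have [glt gwo gltP] := well_ordered_pairs wo.
set S := seg lt i.
have [h hE] := wf_rec point (wo_wf gwo) (fun p f =>
  xget point [set k | S k /\ forall q, glt q p -> (S `*` S) q -> f q <> k]).
have hP p : (S `*` S) p ->
    S (h p) /\ forall q, glt q p -> (S `*` S) q -> h q <> h p.
  move=> [p1 p2].
  suff : exists k, S k /\ forall q, glt q p -> (S `*` S) q -> h q <> k.
    move=> [k [Sk kP]].
    have [] := @xgetPex _ point [set k | S k /\ forall q,
        glt q p -> (S `*` S) q ->
        (fun y => if pselect (glt y p) then h y else point) q <> k].
      by exists k; split=> // q; case: pselect => // qp _; apply: kP.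
    rewrite -hE => Sh hh; split=> // q qp Sq.
    by have := hh q qp Sq; case: pselect.
  apply: contrapT => nok.
  (* If no value is free, the values on the predecessors of [p] exhaust [S]. These predecessors lie
     in the square of the segment up to some [m] in [S], so [S] is finite or injects into
     [seg lt m], against [noj]. *)
  have cover : S `<=` h @` [set q | glt q p /\ (S `*` S) q].
    move=> k Sk; apply: contrapT => kh; apply: nok; exists k; split=> // q qp Sq.
    by move=> hq; apply: kh; exists q.
  have [m Sm mP] : exists2 m, S m & forall q, glt q p ->
      (lt q.1 m \/ q.1 = m) /\ (lt q.2 m \/ q.2 = m).
    have [[q0 q0p]|noq] := pselect (exists q, glt q p); last first.
      by exists p.1 => // q qp; case: noq; exists q.
    have [] := wo_total wo p.1 p.2 => p12.
    - exists p.2 => // q /gltP [m [] ->] // [q1 q2].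
      split; left; [case: q1 => [q1|->]|case: q2 => [q2|->]] => //.
      + exact: (wo_trans wo) p12.
      + exact: (wo_trans wo) p12.
    - by exists p.1 => // q /gltP [m [] ->]; rewrite -?p12.
    - exists p.1 => // q /gltP [m [] ->] // [q1 q2].
      split; left; [case: q1 => [q1|->]|case: q2 => [q2|->]] => //.
      + exact: (wo_trans wo) p12.
      + exact: (wo_trans wo) p12.
  pose A := [set k | lt k m \/ k = m].
  have SA : S #<= A `*` A.
    apply: card_le_trans (subset_card_le cover) _.
    apply: card_le_trans (card_image_le _ _) _.
    by apply: subset_card_le => q [/mP].
  have [mfin|minf] := pselect (finite_set (seg lt m)).
    apply: iinf; apply: card_le_finite SA _.
    have Afin : finite_set A.
      rewrite (_ : A = seg lt m `|` [set m]) ?finite_setU; first by split.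
      by apply/seteqP; split.
    exact: finite_setX.
  apply: noj; exists m; first exact: Sm.
  have [a [b [ma mb ab]]] := infinite_two minf.
  have IHm := IH m Sm minf.
  have Am : A #<= seg lt m.
    apply: (card_le_trans _ IHm).
    have irr : ~ lt m m.
      by elim: (wo_wf wo m) => x _ IHx xx; exact: (IHx x).
    (* The top element [m] goes to [(b, b)], which differs from each [(k, a)] since [a <> b]. *)
    apply: (@card_leW _ _ _ _ (fun k => if `[< lt k m >] then (k, a) else (b, b))).
      by move=> k _; case: asboolP => km; split.
    move=> k l; rewrite !inE => Ak Al.
    case: asboolP => km; case: asboolP => lm.
    - by case.
    - by case=> _ /ab.
    - by case=> _ /esym/ab.
    - by move=> _; case: Ak => // ->; case: Al.
  apply: card_le_trans SA _.
  exact: card_le_trans (card_le_setX Am Am) IHm.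
apply: (@card_leW _ _ _ _ h); first by move=> p /hP[].
move=> p q; rewrite !inE => Sp Sq hpq.
have [pq|//|qp] := wo_total gwo p q.
- by case: (hP q Sq) => _ /(_ p pq Sp); rewrite hpq.
- by case: (hP p Sp) => _ /(_ q qp Sq); rewrite hpq.
Qed.

Definition seqs {T : Type} (S : set T) : set (seq T) :=
  [set t | foldr (fun x P => S x /\ P) True t].

(** Sequences are coded by iterated pairing. The length is recorded as well, because the code [e 0]
    of the empty sequence may itself be a value of [p]. *)
Lemma seqs_le {T U : pointedType} (S : set T) (V : set U) :
  infinite_set V -> V `*` V #<= V -> S #<= V -> seqs S #<= V.
Proof.
move=> /infiniteP/card_le_ex[e eV einj] /card_le_ex[p pV pinj].
move=> /card_le_ex[g gV ginj].
pose enc := foldr (fun x v => p (g x, v)) (e 0).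
have encV t : seqs S t -> V (enc t).
  elim: t => [|x t IH] /=; first by move=> _; apply: eV.
  by move=> [Sx St]; apply: pV; split; [apply: gV|apply: IH].
apply: (@card_leW _ _ _ _ (fun t => p (e (size t), enc t))).
  by move=> t St; apply: pV; split; [apply: eV|apply: encV].
have pair_inj (w v w' v' : U) : V w -> V v -> V w' -> V v' ->
    p (w, v) = p (w', v') -> w = w' /\ v = v'.
  move=> Vw Vv Vw' Vv' pp.
  by have [-> ->] : (w, v) = (w', v') by apply: pinj => //; rewrite inE.
move=> t u; rewrite !inE => St Su tu.
have [/einj] := pair_inj _ _ _ _ (eV _ Logic.I) (encV _ St)
  (eV _ Logic.I) (encV _ Su) tu.
rewrite !inE => /(_ Logic.I Logic.I) {}tu.
elim: t u St Su tu => [|x t IH] [|y u] //= [Sx St] [Sy Su] [tu] tu'.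
have [gxy /(IH _ St Su tu) ->] := pair_inj _ _ _ _ (gV _ Sx) (encV _ St)
  (gV _ Sy) (encV _ Su) tu'.
by congr cons; apply: ginj => //; rewrite inE.
Qed.

Lemma continuum_not_countable : ~ (continuum #<= [set: nat]).
Proof.
move=> /card_le_ex[f _ finj].
pose d n := `[< exists2 x, f x = n & x n = false >].
have [dd|dd] := boolP (d (f d)).
  move: (dd); rewrite {1}/d => /asboolP[x /finj].
  by rewrite !inE => -> //; rewrite dd.
by move/asboolPn: (dd); apply; exists d => //; apply/negbTE.
Qed.

Definition small {T : Type} (S : set T) : Prop := ~ (continuum #<= S).

(** Pairs of sequences index the combinations of earlier compact sets. They inject into the segment
    itself if it is infinite, and into [nat] otherwise. *)
Lemma small_seqs {T : pointedType} (lt : T -> T -> Prop) (i : T) :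
  well_ordered lt -> small (seg lt i) ->
  small (seqs (seg lt i) `*` seqs (seg lt i)).
Proof.
move=> wo ism.
have key (U : pointedType) (V : set U) : infinite_set V -> V `*` V #<= V ->
    seg lt i #<= V -> small V -> small (seqs (seg lt i) `*` seqs (seg lt i)).
  move=> Vinf VV iV Vsm H; apply: Vsm; apply: card_le_trans H _.
  by apply: (card_le_trans _ VV); apply: card_le_setX; apply: seqs_le.
have [ifin|iinf] := pselect (finite_set (seg lt i)); last first.
  by apply: key ism => //; exact: seg_square.
apply: (key nat setT) => //.
- exact: infinite_nat.
- exact: countableP.
- exact: finite_set_countable.
- exact: continuum_not_countable.
Qed.

Lemma not_dominating_family {T I : Type} (C : set T) (S : set I)
    (g : I -> nat -> nat) :
  min_card dominating C -> ~ (C #<= S) ->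
  exists f, forall i, S i -> ~ eventually_le f (g i).
Proof.
move=> [_ domC] Ssm.
apply: contrapT => Nf; apply: Ssm.
apply: card_le_trans (card_image_le g S); apply: domC => f.
apply: contrapT => Nfg; apply: Nf; exists f => i Si fgi.
by apply: Nfg; exists (g i) => //; exists i.
Qed.

Lemma not_reaping_family {T I : Type} (C : set T) (S : set I)
    (E : I -> set nat) :
  min_card reaping C -> ~ (C #<= S) -> (forall i, S i -> infinite_set (E i)) ->
  exists X, forall i, S i -> splits X (E i).
Proof.
move=> [_ reapC] Ssm Einf.
apply: contrapT => NX; apply: Ssm.
apply: card_le_trans (card_image_le E S); apply: reapC; split.
  by move=> _ [i Si <-]; exact: Einf.
by move=> [X XP]; apply: NX; exists X => i Si; apply: XP; exists i.
Qed.

(** Any well-order will do: either all its segments are small, or the first segment that is not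
    small is large enough and consists of points with small segments. *)
Lemma small_initial_segments :
  exists2 lt : (nat -> bool) -> (nat -> bool) -> Prop, well_ordered lt &
    continuum #<= [set i | small (seg lt i)].
Proof.
have [lt wo] := well_ordered_exists (nat -> bool).
exists lt => //.
have [all_small|] := pselect (forall i, small (seg lt i)).
  by apply: subset_card_le => i _; exact: all_small.
move=> /existsNP[i]; elim: (wo_wf wo i) => {}i _ IH.
have [[j ji jNs]|Hi] := pselect (exists2 j, lt j i & ~ small (seg lt j)).
  by move=> _; apply: IH jNs.
move=> /contrapT H; apply: card_le_trans H _; apply: subset_card_le.
by move=> j ji; apply: contrapT => jNs; apply: Hi; exists j.
Qed.

(** * Compactness in the Cantor space *)

Lemma compact_increasing {X : topologicalType} (C : set X)
    (O : nat -> set X) :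
  compact C -> (forall m, open (O m)) ->
  (forall m n, (m <= n)%N -> O m `<=` O n) -> C `<=` \bigcup_m O m ->
  exists m, C `<=` O m.
Proof.
move=> /compact_near_coveringP Ccpt Oopen Oincr CO.
have [|m _ /(_ m (leqnn m)) CP] := Ccpt _ \oo (fun m x => O m x) _; last first.
  by exists m.
move=> x /CO[m _ Omx].
exists (O m, [set k | (m <= k)%N]) => /=.
  by split; [exact: open_nbhs_nbhs|exists m].
by move=> [y k] [/= Omy mk]; exact: Oincr Omy.
Qed.

Definition agree (s : seq nat) (x y : nat -> bool) : Prop :=
  forall n, n \in s -> y n = x n.

Lemma nbhs_agree (x : cantor_space) (s : seq nat) :
  nbhs x [set y : cantor_space | agree s x y].
Proof.
elim: s => [|n s IH]; first by apply: filterS filterT.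
have nn : nbhs x [set y : cantor_space | y n = x n].
  have /(_ [set x n]) := @proj_continuous _ (fun _ : nat => bool) n x.
  by apply; rewrite /= /nbhs /= ; apply/principal_filterP.
apply: filterS (filterI nn IH) => y [/= yn ys] k.
by rewrite inE => /predU1P[->|/ys].
Qed.

Lemma open_agree (O : set cantor_space) :
  (forall x, O x -> exists s, forall y, agree s x y -> O y) -> open O.
Proof.
move=> OP; rewrite openE => x /OP[s sP].
by apply: filterS (nbhs_agree x s).
Qed.

Lemma open_agree2 (O : set (cantor_space * cantor_space)) :
  (forall x, O x -> exists s, forall y,
     agree s x.1 y.1 -> agree s x.2 y.2 -> O y) -> open O.
Proof.
move=> OP; rewrite openE => x /OP[s sP].
exists ([set y | agree s x.1 y], [set y | agree s x.2 y]).
  by split; exact: nbhs_agree.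
by move=> y [/= y1 y2]; apply: sP.
Qed.

Lemma compact_agree (C : set cantor_space) :
  (forall x, ~ C x -> exists s, forall y, agree s x y -> ~ C y) -> compact C.
Proof.
move=> CP; apply: (@subclosed_compact _ _ [set: cantor_space]) => //; last first.
  exact: cantor_space_compact.
by rewrite -openC; exact: open_agree.
Qed.

Definition meetc (x y : cantor_space) : cantor_space := fun n => x n && y n.

Definition meetsc (C D : set cantor_space) : set cantor_space :=
  [set meetc x y | x in C & y in D].

Lemma compact_meetsc (C D : set cantor_space) :
  compact C -> compact D -> compact (meetsc C D).
Proof.
move=> Ccpt Dcpt.
rewrite (_ : meetsc C D = (fun p => meetc p.1 p.2) @` (C `*` D)); last first.
  apply/seteqP; split => [_ [x Cx [y Dy <-]]|_ [[x y] [/= Cx Dy] <-]].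
    by exists (x, y).
  by exists x => //; exists y.
apply: continuous_compact (compact_setX Ccpt Dcpt).
apply: continuous_subspaceT => p.
apply/cvg_sup => n U [B [[A oA <-] /= An] BU].
have : nbhs p [set q : cantor_space * cantor_space |
    agree [:: n] p.1 q.1 /\ agree [:: n] p.2 q.2].
  exists ([set y | agree [:: n] p.1 y], [set y | agree [:: n] p.2 y]).
    by split; exact: nbhs_agree.
  by move=> y [].
apply: filterS => q [q1 q2]; apply: BU => /=.
by rewrite /meetc q1 ?mem_head// q2 ?mem_head.
Qed.

(** * The Menger property in terms of finite sets *)

(** [A] stands for the open set of all supersets of its elements; so [X] has to include an element
    of [A], not merely meet it. *)
Definition hits (A : set (seq nat)) (X : nat -> bool) : Prop :=
  exists2 a, A a & all X a.

Definition bounded_by (f : nat) : set (seq nat) :=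
  [set a | all (fun n => n < f)%N a].

Definition upward_closed (F : set (set nat)) : Prop :=
  forall X Y, F X -> X `<=` Y -> F Y.

(** For [X] in [F] the supersets of [X] form a compact subset of [F], so finitely many members of
    [U n] cover them, and by compactness these already cover all members of [F] that include a
    certain finite part of [X]. The set [A n] collects such finite parts. *)
Lemma menger_upward (F : set (set nat)) : upward_closed F ->
  (forall A : nat -> set (seq nat),
    (forall n X, F X -> hits (A n) (char_fun X)) ->
    exists f, forall X, F X ->
      exists n, hits (A n `&` bounded_by (f n)) (char_fun X)) ->
  menger_family F.
Proof.
move=> Fup Fhits U Ucover.
pose M : set cantor_space := char_fun @` F.
pose cone (a : seq nat) : set M := [set x : M | all (set_val x) a].
pose A n : set (seq nat) := [set a | exists W : set (set M),
  [/\ finite_set W, W `<=` U n & cone a `<=` \bigcup_(O in W) O]].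
have Ahits n X : F X -> hits (A n) (char_fun X).
  move=> FX; have [Uopen Ucov] := Ucover n.
  pose up : set cantor_space := [set y | forall k, X k -> y k].
  have upM : up `<=` M.
    move=> y upy; exists [set k | y k]; first exact: Fup FX _.
    by apply/funext => k; apply/idP/idP => [/asboolP|?]; [|exact/asboolP].
  have upcpt : compact up.
    apply: compact_agree => y /existsNP[k /not_implyP[Xk yk]]; exists [:: k].
    by move=> z zy /(_ k Xk); rewrite zy ?mem_head.
  pose I := {classic set cantor_space}.
  pose D : set I := [set O | open (O : set cantor_space) /\ U n (set_val @^-1` O)].
  have := upcpt; rewrite compact_cover => /(_ I D id) [].
  - by move=> O [].
  - move=> y upy; have /mem_set My := upM y upy.
    have : [set: M] (SigSub My) by [].
    rewrite -Ucov => -[O UO Oy]; have [O' oO' O'O] := Uopen O UO.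
    by exists O'; [split=> //; rewrite O'O|move: Oy; rewrite -O'O].
  move=> E ED upE.
  pose O' : set cantor_space := \bigcup_(O in [set` E]) (O : set cantor_space).
  have O'open : open O'.
    by apply: bigcup_open => O /= /ED; rewrite inE => -[].
  (* Points outside [O'] are not in [up], so they miss an element of [X]; compactness bounds such an
     element by [m]. The elements of [X] below [m] are the required finite part. *)
  have [m mP] : exists m, ~` O' `<=`
      [set y | exists2 k, (k < m)%N & X k /\ ~ y k].
    apply: compact_increasing.
    - apply: (@subclosed_compact _ _ [set: cantor_space]) => //.
        exact: open_closedC.
      exact: cantor_space_compact.
    - move=> m; apply: open_agree => y [k km [Xk yk]]; exists [:: k] => z zy.
      by exists k => //; rewrite zy ?mem_head.
    - by move=> m k mk y [l lm ?]; exists l => //; exact: leq_trans mk.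
    - move=> y O'y; have /existsNP[k /not_implyP[Xk yk]] : ~ up y.
        by move=> /upE[O EO Oy]; apply: O'y; exists O.
      by exists k.+1 => //; exists k.
  exists [seq k <- iota 0 m | char_fun X k]; last first.
    by apply/allP => k; rewrite mem_filter => /andP[].
  exists ((fun O : I => set_val @^-1` (O : set cantor_space)) @` [set` E]).
  split.
  - exact/finite_image/finite_fset.
  - by move=> _ [O /= /ED + <-]; rewrite inE => -[].
  - move=> x /= /allP xX; have [[O EO Ox]|nOx] := pselect (O' (set_val x)).
      by exists (set_val @^-1` (O : set cantor_space)) => //; exists O.
    have [k km [Xk]] := mP _ nOx; case.
    apply: xX; rewrite mem_filter mem_iota add0n km; apply/andP; split=> //.
    exact/asboolP.
have [f fP] := Fhits A Ahits.
have /choice[W WP] : forall na : nat * seq nat, exists W : set (set M),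
    [/\ finite_set W, W `<=` U na.1 &
      A na.1 na.2 -> cone na.2 `<=` \bigcup_(O in W) O].
  move=> [n a]; have [[W [Wfin WU aW]]|nAna] := pselect (A n a).
    by exists W.
  by exists set0; split.
(* Infinitely many sequences have all entries below [f n], but [A n] only depends on the set of
   entries. Boolean masks list each such set once, which keeps the selection finite. *)
pose sub n (b : (f n).-tuple bool) := mask b (iota 0 (f n)).
exists (fun n => \bigcup_(b in [set: (f n).-tuple bool]) W (n, sub n b)).
split=> [n|].
  split; last by move=> O [b _]; have [_ + _] := WP (n, sub n b); apply.
  apply: bigcup_finite; first exact: finite_finset.
  by move=> b _; have [] := WP (n, sub n b).
apply/seteqP; split=> // x _.
have [X FX Xx] : M (set_val x) by exact: set_valP.
have [n [a [Aa af] aX]] := fP X FX.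
have sz : size [seq k \in a | k <- iota 0 (f n)] == f n.
  by rewrite size_map size_iota.
have subE k : (k \in sub n (Tuple sz)) = (k \in a).
  rewrite /sub /= -filter_mask mem_filter mem_iota add0n /=.
  by apply: andb_idr => ka; exact: (allP af).
have Asub : A n (sub n (Tuple sz)).
  have [V [Vfin VU aV]] := Aa; exists V; split=> // y /allP ysub.
  by apply: aV; apply/allP => k ka; apply: ysub; rewrite subE.
have [_ _ /(_ Asub)/(_ x) [|O WO Ox]] := WP (n, sub n (Tuple sz)).
  rewrite /cone /= -Xx; apply/allP => k; rewrite subE => ka.
  exact: (allP aX).
by exists n => //; exists O => //; exists (Tuple sz).
Qed.

(** * The steps of the construction *)

Definition topc : cantor_space := fun=> true.

Fixpoint finite_meets {T : Type} (K : T -> set cantor_space) (t : seq T) :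
    set cantor_space :=
  if t is j :: t' then meetsc (K j) (finite_meets K t') else [set topc].

(* Only the head of [u] matters; indexing by sequences lets the empty sequence
   stand for the full set, which is always positive. *)
Definition witnesses {T : Type} (L : T -> set cantor_space) (u : seq T) :
    set cantor_space :=
  if u is j :: _ then L j else [set topc].

(* Adding [Ki] to the filter may use several of its elements, hence the finite
   family [Z]. *)
Definition extends {T : Type} (K L : T -> set cantor_space) (S : set T)
    (Ki Li : set cantor_space) : Prop :=
  forall t F k (Z : nat -> cantor_space) H,
    seqs S t -> finite_meets K t F -> (forall i, (i < k)%N -> Ki (Z i)) ->
    (exists2 u, seqs S u & witnesses L u H) \/ Li H ->
  forall m, exists x, [/\ (m <= x)%N, F x, forall i, (i < k)%N -> Z i x & H x].

(** The invariant of the recursion. Unbounded intersections, and not just nonempty ones, leave room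
    for the cofinite sets in the filter. *)
Definition compatible {T : Type} (K L : T -> set cantor_space) (S : set T) :
    Prop :=
  forall t u F H, seqs S t -> seqs S u -> finite_meets K t F ->
    witnesses L u H -> forall m, exists x, [/\ (m <= x)%N, F x & H x].

(** The bound [m] puts the cofinite sets into the filter, already for empty [t]. *)
Definition generated {T : Type} (K : T -> set cantor_space) (S : set T) :
    set cantor_space :=
  [set X | exists t F m, [/\ seqs S t, finite_meets K t F &
    forall x, (m <= x)%N -> F x -> X x]].

Lemma seqs_cat {T : Type} (S : set T) (t t' : seq T) :
  seqs S t -> seqs S t' -> seqs S (t ++ t').
Proof. by elim: t => [|j t IH] //= [Sj St] St'; split=> //; exact: IH. Qed.

Lemma seqs_sub {T : Type} (S S' : set T) (t : seq T) :
  S `<=` S' -> seqs S t -> seqs S' t.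
Proof. by move=> SS'; elim: t => [|j t IH] //= [/SS' Sj /IH St]. Qed.

Lemma finite_meets_cat {T : Type} (K : T -> set cantor_space) (t t' : seq T)
    (F F' : cantor_space) :
  finite_meets K t F -> finite_meets K t' F' ->
  finite_meets K (t ++ t') (meetc F F').
Proof.
elim: t F => [|j t IH] F /=; first by move=> ->.
move=> [X KX [Y tY <-]] tF'; exists X => //; exists (meetc Y F'); first exact: IH.
by apply/funext => x; rewrite /meetc andbA.
Qed.

Lemma finite_meets_eq {T : Type} (K K' : T -> set cantor_space) (S : set T) t :
  (forall j, S j -> K j = K' j) -> seqs S t ->
  finite_meets K t = finite_meets K' t.
Proof. by move=> KK'; elim: t => [|j t IH] //= [/KK'-> /IH->]. Qed.

Lemma generated_meetc {T : Type} (K : T -> set cantor_space) (S : set T) X Y :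
  generated K S X -> generated K S Y -> generated K S (meetc X Y).
Proof.
move=> [t [F [m [St tF FX]]]] [t' [F' [m' [St' tF' FX']]]].
exists (t ++ t'), (meetc F F'), (maxn m m'); split.
- exact: seqs_cat.
- exact: finite_meets_cat.
- move=> x; rewrite geq_max => /andP[mx m'x] /andP[Fx F'x].
  by rewrite /meetc FX ?FX'.
Qed.

Lemma compact_finite_meets {T : Type} (K : T -> set cantor_space) (S : set T) t :
  (forall j, S j -> compact (K j)) -> seqs S t -> compact (finite_meets K t).
Proof.
move=> Kcpt; elim: t => [|j t IH] /=; first by move=> _; exact: compact_set1.
by move=> [Sj St]; apply: compact_meetsc; [exact: Kcpt|exact: IH].
Qed.

Lemma compact_witnesses {T : Type} (L : T -> set cantor_space) (S : set T) u :
  (forall j, S j -> compact (L j)) -> seqs S u -> compact (witnesses L u).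
Proof.
case: u => [|j u] Lcpt /=; first by move=> _; exact: compact_set1.
by move=> [Sj _]; exact: Lcpt.
Qed.

(** In a finite meet over the enlarged index set, the factors from [Ki] are collected in [Z]; the
    others form a meet over [S], and [extends] applies to both together. *)
Lemma extends_compatible {T : Type} (K L K' L' : T -> set cantor_space)
    (S : set T) (i : T) (Ki Li : set cantor_space) :
  extends K L S Ki Li ->
  (forall j, S j -> K' j = K j /\ L' j = L j) -> K' i = Ki -> L' i = Li ->
  compatible K' L' (S `|` [set i]).
Proof.
move=> ext eqS K'i L'i t u F H St Su tF uH m.
have [t0 [F0 [k [Z [St0 tF0 KZ F0F]]]]] : exists t0 F0 k (Z : nat -> cantor_space),
    [/\ seqs S t0, finite_meets K t0 F0, forall i, (i < k)%N -> Ki (Z i) &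
        forall x, F0 x -> (forall i, (i < k)%N -> Z i x) -> F x].
  elim: t F St tF {uH} => [|j t IH] F /=.
    move=> _ ->; exists [::], topc, 0%N, (fun=> topc); split => //.
  move=> [Sj St] [X KX [Y tY <-]].
  have [t0 [F0 [k [Z [St0 tF0 KZ F0F]]]]] := IH Y St tY.
  case: Sj => [Sj|/= ji].
    exists (j :: t0), (meetc X F0), k, Z; split => //=.
    - by exists X; [have [<-] := eqS j Sj|exists F0].
    - by move=> x /andP[Xx F0x] Zx; rewrite /meetc Xx F0F.
  exists t0, F0, k.+1, (fun l => if l is l'.+1 then Z l' else X); split => //.
  - by case=> [|l] lk; [rewrite -K'i -ji|exact: KZ].
  - move=> x F0x Zx; rewrite /meetc (Zx 0%N)//= F0F// => l lk.
    exact: (Zx l.+1).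
have [|x [mx F0x Zx Hx]] := ext t0 F0 k Z H St0 tF0 KZ _ m.
  case: u Su uH => [|j u] /=; first by move=> _ ->; left; exists [::].
  move=> [[Sj|/= ->] _] L'H; last by right; rewrite -L'i.
  left; exists [:: j] => //=; by have [_ <-] := eqS j Sj.
by exists x; split => //; exact: F0F.
Qed.

(** Equivalently, the complement of [Y] includes no element of [A n] bounded by [f n], for any
    [n]. *)
Definition hitting (A : nat -> set (seq nat)) (f : nat -> nat) :
    set cantor_space :=
  [set Y | forall n a, A n a -> bounded_by (f n) a -> has Y a].

Lemma compact_hitting A f : compact (hitting A f).
Proof.
apply: compact_agree => y /existsNP[n /existsNP[a]].
move=> /not_implyP[Aa /not_implyP[af ya]]; exists a => z zy hitz.
apply: ya; have /hasP[k ka zk] := hitz n a Aa af.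
by apply/hasP; exists k => //; rewrite -zy.
Qed.

Lemma hits_uniform (A : set (seq nat)) (C : set cantor_space) :
  compact C -> (forall F, C F -> hits A F) ->
  exists m, forall F, C F -> hits (A `&` bounded_by m) F.
Proof.
move=> Ccpt CA.
apply: (@compact_increasing _ C (fun m => [set F | hits (A `&` bounded_by m) F])).
- exact: Ccpt.
- move=> m; apply: open_agree => F [a Aa aF]; exists a => y yF.
  by exists a => //; apply/allP => k ka; rewrite yF//; exact: (allP aF).
- move=> m n mn F [a [Aa am] aF]; exists a => //; split => //.
  by apply: sub_all am => k km; exact: leq_trans mn.
- move=> F /CA[a Aa aF]; exists (\max_(k <- a) k).+1 => //; exists a => //.
  by split => //; apply/allP => k ka; rewrite ltnS; exact: leq_bigmax_seq.
Qed.

Lemma not_eventually_leP (f g : nat -> nat) :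
  ~ eventually_le f g -> forall m, exists2 n, (m <= n)%N & (g n < f n)%N.
Proof.
move=> Nfg m; apply: contrapT => H; apply: Nfg; exists m => // n /= mn.
by rewrite leqNgt; apply/negP => gf; apply: H; exists n.
Qed.

(** This and [splittable] are the forms in which d = c and r = c enter the steps, for index sets
    smaller than the continuum. *)
Definition escapable {I : Type} (S : set I) : Prop :=
  forall g : I -> nat -> nat,
    exists f, forall i, S i -> forall m, exists2 n, (m <= n)%N & (g i n < f n)%N.

Definition splittable {I : Type} (S : set I) : Prop :=
  forall E : I -> set nat, (forall i, S i -> infinite_set (E i)) ->
    exists X, forall i, S i -> splits X (E i).

(** If no suitable [Z] can be added, every finite meet [F] includes an element of each [A n], within
    a bound that depends only on [n] and the combination of compact sets. Wherever [f] exceeds this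
    bound, each set in [hitting A f] meets [F]. *)
Lemma filter_step {T : Type} (K L : T -> set cantor_space) (S : set T)
    (A : nat -> set (seq nat)) :
  compatible K L S -> (forall j, S j -> compact (K j)) ->
  escapable (seqs S `*` seqs S) ->
  exists Ki Li, [/\ compact Ki, compact Li, extends K L S Ki Li &
    (exists n Z, Ki Z /\ ~ hits (A n) Z) \/ exists f, hitting A f `<=` Li].
Proof.
move=> compS Kcpt esc.
have [[n [Z [Zcomp Zhits]]]|noZ] := pselect (exists n (Z : cantor_space),
    (forall t u F H, seqs S t -> seqs S u -> finite_meets K t F ->
      witnesses L u H -> forall m, exists x, [/\ (m <= x)%N, F x, Z x & H x]) /\
    ~ hits (A n) Z).
  exists [set Z], set0; split.
  - exact: compact_set1.
  - exact: compact0.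
  - move=> t F k Y H St tF Yk [[u Su uH]|//] m.
    have [x [mx Fx Zx Hx]] := Zcomp t u F H St Su tF uH m.
    by exists x; split => // i /Yk ->.
  - by left; exists n, Z.
(* Removing the numbers below [n] from [F] preserves compatibility, so the element of [A n] may be
   taken from [n] on; this makes the common elements unbounded. *)
have Ahits n t F : seqs S t -> finite_meets K t F ->
    hits (A n `&` [set a | all (leq n) a]) F.
  move=> St tF; apply: contrapT => NF; apply: noZ.
  exists n, (fun x => (n <= x)%N && F x); split.
    move=> t' u F' H St' Su tF' uH m.
    have [x [mx /andP[Fx F'x] Hx]] := compS (t ++ t') u (meetc F F') H
      (seqs_cat St St') Su (finite_meets_cat tF tF') uH (maxn m n).
    by move: mx; rewrite geq_max => /andP[mx nx]; exists x; rewrite nx.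
  move=> [a Aa aF]; apply: NF; exists a.
    by split=> //; apply: sub_all aF => x /andP[].
  by apply: sub_all aF => x /andP[].
have /choice[g gP] : forall p : seq T * seq T, exists g : nat -> nat,
    seqs S p.1 -> forall n F, finite_meets K p.1 F ->
    hits (A n `&` [set a | all (leq n) a] `&` bounded_by (g n)) F.
  move=> [t u] /=; have [St|] := pselect (seqs S t); last by exists id.
  have /choice[g gP] : forall n, exists m, forall F, finite_meets K t F ->
      hits (A n `&` [set a | all (leq n) a] `&` bounded_by m) F.
    move=> n; apply: hits_uniform; first exact: compact_finite_meets St.
    by move=> F; exact: Ahits.
  by exists g => _ n F; exact: gP.
have [f fP] := esc g.
exists set0, (hitting A f); split.
- exact: compact0.
- exact: compact_hitting.
- move=> t F [|k] Z H St tF Z0 LH m; last by have := Z0 0%N erefl.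
  case: LH => [[u Su uH]|HH].
    by have [x [mx Fx Hx]] := compS t u F H St Su tF uH m; exists x.
  have [n mn gf] := fP (t, [::]) (conj St Logic.I) m.
  have [a [[Aa na] ag] aF] := gP (t, [::]) St n F tF.
  have /hasP[x xa Hx] : has H a.
    apply: HH Aa _; apply: sub_all ag => x xg; exact: ltn_trans gf.
  exists x; split => //; last exact: (allP aF).
  by apply: leq_trans mn _; exact: (allP na).
- by right; exists f.
Qed.

(** Several sets from [hitting A f] may enter one intersection, so bounds are needed for many sets
    at once: in [good], [n] is both the number of sets and a lower bound for their common
    element. *)
Lemma positive_step {T : Type} (K L : T -> set cantor_space) (S : set T)
    (A : nat -> set (seq nat)) :
  compatible K L S -> (forall j, S j -> compact (K j) /\ compact (L j)) ->
  escapable (seqs S `*` seqs S) ->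
  exists Ki Li, [/\ compact Ki, compact Li, extends K L S Ki Li &
    (exists n Z, Li Z /\ ~ hits (A n) Z) \/ exists f, hitting A f `<=` Ki].
Proof.
move=> compS KLcpt esc.
pose posi (Z : cantor_space) := forall t F, seqs S t -> finite_meets K t F ->
  forall m, exists x, [/\ (m <= x)%N, F x & Z x].
have [[n [Z [Zpos Zhits]]]|noZ] := pselect (exists n (Z : cantor_space),
    posi Z /\ ~ hits (A n) Z).
  exists set0, [set Z]; split.
  - exact: compact0.
  - exact: compact_set1.
  - move=> t F [|k] Y H St tF Y0 LH m; last by have := Y0 0%N erefl.
    have [x [mx Fx Hx]] : exists x, [/\ (m <= x)%N, F x & H x].
      case: LH => [[u Su uH]|->]; first exact: compS St Su tF uH m.
      exact: Zpos St tF m.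
    by exists x.
  - by left; exists n, Z.
have Ahits n Z : posi Z -> hits (A n) Z.
  by move=> Zpos; apply: contrapT => NZ; apply: noZ; exists n, Z.
pose diff (W Z : cantor_space) : cantor_space := fun x => W x && ~~ Z x.
(* If [W] misses the intersection of [Z 0], ..., [Z n.-1] from [n] on, then some
   [W `\` Z i] is positive, hence includes an element of [A n]. *)
pose good n m (W : cantor_space) (Z : nat -> cantor_space) :=
  (exists x, [/\ (n <= x < m)%N, W x & forall i, (i < n)%N -> Z i x]) \/
  (exists2 i, (i < n)%N & hits (A n `&` bounded_by m) (diff W (Z i))).
have good_ex t u n W Z : seqs S t -> seqs S u ->
    meetsc (finite_meets K t) (witnesses L u) W -> exists m, good n m W Z.
  move=> St Su [F tF [H uH WE]].
  have [[i ni Zi]|Nhits] := pselect (exists2 i, (i < n)%N &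
      posi (diff W (Z i))).
    have [a Aa aW] := Ahits n _ Zi.
    exists (\max_(k <- a) k).+1; right; exists i => //; exists a => //.
    by split => //; apply/allP => k ka; rewrite ltnS; exact: leq_bigmax_seq.
  (* Each difference that is not positive is avoided by some generated set; [X] is the intersection
     of these sets for all [i] below [n]. *)
  have [X [t' [F' [m' [St' tF' F'X]]]] WXZ] : exists2 X, generated K S X &
      forall x, X x -> W x -> forall i, (i < n)%N -> Z i x.
    have : forall i, (i < n)%N -> ~ posi (diff W (Z i)).
      by move=> i ni Zi; apply: Nhits; exists i.
    elim: (n) => [|l IH] lposi.
      exists topc => //; exists [::], topc, 0%N; split => //.
    have [i il|X GX XZ] := IH; first by apply: lposi; rewrite ltnS ltnW.
    have := lposi l (leqnn _) => /existsNP[t' /existsNP[F']].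
    move=> /not_implyP[St' /not_implyP[tF' /existsNP[m' Hm']]].
    exists (meetc X (fun x => F' x && (m' <= x)%N)).
      apply: generated_meetc => //; exists t', F', m'; split => //.
      by move=> x m'x F'x; rewrite F'x.
    move=> x /and3P[Xx F'x m'x] Wx i; rewrite ltnS leq_eqVlt => /predU1P[->|].
      by apply: contrapT => /negP Zx; apply: Hm'; exists x; rewrite /diff Wx.
    exact: XZ.
  have [x [mx /andP[Fx F'x] Hx]] := compS (t ++ t') u (meetc F F') H
    (seqs_cat St St') Su (finite_meets_cat tF tF') uH (maxn m' n).
  move: mx; rewrite geq_max => /andP[m'x nx].
  have Wx : W x by rewrite -WE /meetc Fx.
  exists x.+1; left; exists x; split => //; first by rewrite nx ltnSn.
  by move=> i ni; apply: WXZ => //; exact: F'X.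
(* A sequence of sets is coded as a single point of the Cantor space, so compactness gives a bound
   uniform in [Z] as well as in [W]. *)
pose dec (Z : cantor_space) : nat -> cantor_space :=
  fun i x => Z (choice.pickle (i, x)).
have /choice[g gP] : forall p : seq T * seq T, exists g : nat -> nat,
    seqs S p.1 -> seqs S p.2 -> forall n W Z,
    meetsc (finite_meets K p.1) (witnesses L p.2) W -> good n (g n) W (dec Z).
  move=> [t u] /=; have [St|] := pselect (seqs S t); last by exists id.
  have [Su|] := pselect (seqs S u); last by exists id.
  pose C := meetsc (finite_meets K t) (witnesses L u).
  suff /choice[g gP] : forall n, exists m,
      C `*` setT `<=` [set p | good n m p.1 (dec p.2)].
    by exists g => _ _ n W Z CW; exact: (gP n (W, Z)).
  move=> n; apply: (@compact_increasing _ (C `*` setT)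
    (fun m => [set p | good n m p.1 (dec p.2)])).
  - apply: compact_setX; last exact: cantor_space_compact.
    apply: compact_meetsc.
    + by apply: compact_finite_meets St => j /KLcpt[].
    + by apply: compact_witnesses Su => j /KLcpt[].
  - move=> m; apply: open_agree2 => -[W Z] /= WZ.
    pose s := iota 0 m ++ [seq choice.pickle (i, x) | i <- iota 0 n, x <- iota 0 m].
    have sm x : (x < m)%N -> x \in s by move=> xm; rewrite mem_cat mem_iota xm.
    have sZ i x : (i < n)%N -> (x < m)%N -> choice.pickle (i, x) \in s.
      move=> ni xm; rewrite mem_cat; apply/orP; right.
      by apply/allpairsP; exists (i, x); rewrite !mem_iota.
    exists s => -[W' Z'] /= WW' ZZ'.
    case: WZ => [[x [/andP[nx xm] Wx Zx]]|[i ni [a [Aa am] aW]]].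
      left; exists x; split; [by rewrite nx|by rewrite WW' ?sm|].
      by move=> i ni; rewrite /dec ZZ'; [exact: Zx|exact: sZ].
    right; exists i => //; exists a => //; apply/allP => x xa.
    have xm := allP am x xa.
    have := allP aW x xa; rewrite /diff /dec => WZx.
    by rewrite (WW' x (sm x xm)) (ZZ' _ (sZ i x ni xm)).
  - move=> m m' mm' [W Z] /= [[x [/andP[nx xm] Wx Zx]]|[i ni [a [Aa am] aW]]].
      by left; exists x; split => //; rewrite nx (leq_trans xm).
    right; exists i => //; exists a => //; split => //.
    by apply: sub_all am => k km; exact: leq_trans mm'.
  - move=> [W Z] [/= CW _].
    by have [m mP] := good_ex t u n W (dec Z) St Su CW; exists m.
have [f fP] := esc g.
exists (hitting A f), set0; split.
- exact: compact_hitting.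
- exact: compact0.
- move=> t F k Z H St tF kZ [[u Su uH]|//] m.
  case: k kZ => [|k] kZ.
    by have [x [mx Fx Hx]] := compS t u F H St Su tF uH m; exists x.
  have [n] := fP (t, u) (conj St Su) (maxn m k.+1).
  rewrite geq_max => /andP[mn kn] gf.
  (* [good] speaks of [n] sets with [k < n]; repeating [Z 0] fills the list without leaving
     [hitting A f]. The case of no sets was treated before, for lack of a [Z 0]. *)
  pose Y i := if (i < k.+1)%N then Z i else Z 0%N.
  pose code : cantor_space := fun c =>
    if choice.unpickle c is Some (i, x) then Y i x else true.
  have decE : dec code = Y.
    by apply/funext => i; apply/funext => x; rewrite /dec /code choice.pickleK.
  have KY i : hitting A f (Y i).
    by rewrite /Y; case: ifP => ik; exact: kZ.
  have [] := gP (t, u) St Su n (meetc F H) code.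
  + by exists F => //; exists H.
  + rewrite decE => -[x [/andP[nx _] /andP[Fx Hx] Yx]].
    exists x; split => //; first exact: leq_trans nx.
    move=> i ik; have := Yx i (leq_trans ik kn).
    by rewrite /Y ik.
  + rewrite decE => -[i ni [a [Aa ag] aW]].
    have /hasP[x xa Yx] : has (Y i) a.
      apply: KY Aa _; apply: sub_all ag => x xg; exact: ltn_trans gf.
    by have := allP aW x xa; rewrite /diff Yx andbF.
- by right; exists f.
Qed.

Lemma finite_set_bounded (E : set nat) :
  finite_set E <-> exists m, forall k, E k -> (k < m)%N.
Proof.
split=> [/finite_seqP[s ->]|[m Em]]; last first.
  by apply: sub_finite_set (finite_II m) => k /Em.
by exists (\max_(k <- s) k).+1 => k /= ks; rewrite ltnS; exact: leq_bigmax_seq.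
Qed.

Lemma infinite_set_unbounded (E : set nat) :
  infinite_set E <-> forall m, exists2 k, (m <= k)%N & E k.
Proof.
split=> [Einf m|Eunb /finite_set_bounded[m Em]].
  apply: contrapT => H; apply: Einf; apply/finite_set_bounded; exists m => k Ek.
  by rewrite ltnNge; apply/negP => mk; apply: H; exists k.
by have [k mk /Em] := Eunb m; rewrite ltnNge mk.
Qed.

(** These endpoints are so sparse that, for [n] between [a k] and [a k.+1], the interval [n, f n)
    ends within the next interval at the latest. *)
Lemma interval_sequence (f : nat -> nat) : exists a : nat -> nat,
  [/\ a 0%N = 0%N, forall k, (a k < a k.+1)%N &
      forall k n, (n <= a k)%N -> (f n <= a k.+1)%N].
Proof.
pose step n := (\max_(l < n.+1) f l + n.+1)%N.
exists (fun k => iter k step 0%N); split=> // [k|k n nk] /=.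
  by rewrite /step; exact: leq_addl.
rewrite /step; apply: leq_trans (leq_addr _ _).
exact: (leq_bigmax (Ordinal (nk : (n < (iter k step 0).+1)%N))).
Qed.

Lemma split_step {T : Type} (K L : T -> set cantor_space) (S : set T)
    (phi : nat -> nat) :
  compatible K L S -> (forall j, S j -> compact (K j)) ->
  escapable (seqs S `*` seqs S) -> splittable (seqs S `*` seqs S) ->
  finite_to_one phi ->
  exists Ki Li, [/\ compact Ki, compact Li, extends K L S Ki Li &
    exists X : nat -> bool, Li (fun x => X (phi x)) /\
      Li (fun x => ~~ X (phi x))].
Proof.
move=> compS Kcpt esc spl phifin.
have phi_bound n : exists m, forall x, (phi x < n)%N -> (x < m)%N.
  apply/(finite_set_bounded [set x | (phi x < n)%N]).
  rewrite (_ : [set x | _] = \bigcup_(k in `I_n) (phi @^-1` [set k])).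
    by apply: bigcup_finite => // k _; exact: phifin.
  by apply/seteqP; split=> [x /= xn|x [k /= kn ->]] //; exists (phi x).
have /choice[g gP] : forall p : seq T * seq T, exists g : nat -> nat,
    seqs S p.1 -> forall n F, finite_meets K p.1 F ->
    exists2 x, F x & (n <= phi x < g n)%N.
  move=> [t u] /=; have [St|] := pselect (seqs S t); last by exists id.
  suff /choice[g gP] : forall n, exists m, forall F, finite_meets K t F ->
      exists2 x, F x & (n <= phi x < m)%N.
    by exists g => _ n F; exact: gP.
  move=> n; pose A := [set a : seq nat | exists2 x, (n <= phi x)%N & a = [:: x]].
  have [|F tF|m mP] := @hits_uniform A (finite_meets K t).
  - exact: compact_finite_meets St.
  - have [N NP] := phi_bound n.
    have [x [Nx Fx _]] := compS t [::] F topc St Logic.I tF erefl N.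
    exists [:: x]; last by rewrite /= Fx.
    exists x => //; rewrite leqNgt; apply/negP => /NP.
    by rewrite ltnNge Nx.
  - exists (\max_(x < m) phi x).+1 => F /mP[_ [[x nx ->]]].
    rewrite /bounded_by /= andbT => xm; rewrite andbT => Fx.
    exists x => //; rewrite nx ltnS.
    exact: (@leq_bigmax _ (fun x : 'I_m => phi x) (Ordinal xm)).
(* Escaping the iterated bound leaves room for two consecutive intervals [n, g n) and [g n, g (g n))
   below [f n]. *)
have [f fP] := esc (fun p n => g p (g p n)).
have [a [a0 alt af]] := interval_sequence f.
have amono : {homo a : k l / (k <= l)%N}.
  by apply: homo_leq => [|l k m|k]; [exact: leqnn|exact: leq_trans|exact: ltnW].
have ale k : (k <= a k)%N.
  by elim: k => // k IH; exact: leq_ltn_trans (alt k).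
have bin n : exists k, (a k <= n < a k.+1)%N.
  have ex : exists k, (n < a k)%N by exists n.+1; exact: ale.
  case: (ex_minnP ex) => -[|k]; first by rewrite a0.
  move=> nk kmin; exists k; rewrite nk andbT leqNgt; apply/negP => /kmin.
  by rewrite ltnn.
pose E (p : seq T * seq T) := [set k | forall F, finite_meets K p.1 F ->
  exists2 x, F x & (a k <= phi x < a k.+1)%N].
(* An interval [a k, a k.+2) covers both [n, g n) and [g n, g (g n)), and
   [a k.+1] cannot cut both of them. *)
have [p [St Su]|X0 X0P] := spl E.
  apply/infinite_set_unbounded => m.
  have [n mn gf] := fP p (conj St Su) (a m).
  have [k /andP[kn nk]] := bin n.
  have mk : (m <= k)%N.
    rewrite -ltnS ltnNge; apply/negP => km.
    by have := leq_trans (leq_trans nk (amono _ _ km)) mn; rewrite ltnn.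
  have [gk|kg] := leqP (g p n) (a k.+1).
    exists k => // F /(gP p St n)[x Fx /andP[nx xg]]; exists x => //.
    by rewrite (leq_trans kn nx) (leq_trans xg gk).
  exists k.+1; first exact: leqW.
  move=> F /(gP p St (g p n))[x Fx /andP[nx xg]]; exists x => //.
  rewrite (leq_trans (ltnW kg) nx) (leq_trans xg)//.
  by apply: leq_trans (ltnW gf) (af _ _ (ltnW nk)).
pose X y := `[< exists2 k, X0 k & (a k <= y < a k.+1)%N >].
have XE k y : (a k <= y < a k.+1)%N -> X y = `[< X0 k >].
  move=> /andP[ky yk]; apply/asbool_equiv_eq; split=> [[l X0l /andP[ly yl]]|X0k].
    suff <- : l = k by [].
    apply/eqP; rewrite eqn_leq; apply/andP; split; rewrite leqNgt;
      apply/negP => /amono kl.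
    - by have := leq_trans (leq_trans yk kl) ly; rewrite ltnn.
    - by have := leq_trans (leq_trans yl kl) ky; rewrite ltnn.
  by exists k; rewrite ?ky.
exists set0, [set (fun x => X (phi x) : bool) ; (fun x => ~~ X (phi x))].
split.
- exact: compact0.
- by apply: compactU; exact: compact_set1.
- move=> t F [|k] Z H St tF Z0 LH m; last by have := Z0 0%N erefl.
  have [infX infNX] := X0P (t, [::]) (conj St Logic.I).
  (* Since [k <= a k], an interval whose index exceeds all images of points below [m] contains only
     images of later points. *)
  have late k x : (\max_(x < m) (phi x).+1 <= k)%N -> (a k <= phi x)%N ->
      (m <= x)%N.
    move=> mk kx; rewrite leqNgt; apply/negP => xm.
    have := @leq_bigmax _ (fun x : 'I_m => (phi x).+1) (Ordinal xm).
    move=> /leq_trans/(_ mk)/leq_trans/(_ (ale k))/leq_trans/(_ kx) /=.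
    by rewrite ltnn.
  case: LH => [[u Su uH]|[->|->]].
  + by have [x [mx Fx Hx]] := compS t u F H St Su tF uH m; exists x.
  + have /infinite_set_unbounded/(_ (\max_(x < m) (phi x).+1)) := infX.
    move=> [k mk [Ek X0k]]; have [x Fx kx] := Ek F tF.
    exists x; split => //; first by apply: late mk _; case/andP: kx.
    by rewrite (XE k)//; apply/asboolP.
  + have /infinite_set_unbounded/(_ (\max_(x < m) (phi x).+1)) := infNX.
    move=> [k mk [Ek X0k]]; have [x Fx kx] := Ek F tF.
    exists x; split => //; first by apply: late mk _; case/andP: kx.
    by rewrite (XE k)//; apply/asboolPn.
- by exists X; split; [left|right].
Qed.

(** * The transfinite recursion *)

Inductive task : Type :=
  | FilterCovers of nat -> set (seq nat)
  | PositiveCovers of nat -> set (seq nat)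
  | Split of nat -> nat.

(** For covers, the first alternative shows that [A] does not represent covers of the final family.
    By the second, sets avoiding all bounded elements of [A] have complements that are positive,
    resp. in the filter, so they stay out of the family. *)
Definition handled (tau : task) (Ki Li : set cantor_space) : Prop :=
  match tau with
  | FilterCovers A =>
    (exists n Z, Ki Z /\ ~ hits (A n) Z) \/ exists f, hitting A f `<=` Li
  | PositiveCovers A =>
    (exists n Z, Li Z /\ ~ hits (A n) Z) \/ exists f, hitting A f `<=` Ki
  | Split phi => finite_to_one phi -> exists X : nat -> bool,
      Li (fun x => X (phi x)) /\ Li (fun x => ~~ X (phi x))
  end.

Lemma task_step {T : Type} (K L : T -> set cantor_space) (S : set T)
    (tau : task) :
  compatible K L S -> (forall j, S j -> compact (K j) /\ compact (L j)) ->
  escapable (seqs S `*` seqs S) -> splittable (seqs S `*` seqs S) ->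
  exists Ki Li,
    [/\ compact Ki, compact Li, extends K L S Ki Li & handled tau Ki Li].
Proof.
move=> compS KLcpt esc spl; have Kcpt j : S j -> compact (K j) by move=> /KLcpt[].
case: tau => [A|A|phi] /=.
- exact: filter_step.
- exact: positive_step.
- have [phifin|phiNfin] := pselect (finite_to_one phi).
    have [Ki [Li [? ? ? ?]]] := split_step compS Kcpt esc spl phifin.
    by exists Ki, Li.
  exists set0, set0; split => //; [exact: compact0|exact: compact0|].
  move=> t F [|k] Z H St tF Z0 LH m; last by have := Z0 0%N erefl.
  case: LH => [[u Su uH]|//].
  by have [x [mx Fx Hx]] := compS t u F H St Su tF uH m; exists x.
Qed.

(** There are at most continuum many tasks: the first two bits select the kind, and the others code
    the covers or the graph of the map. *)
Lemma task_code : exists d : (nat -> bool) -> task, forall tau, exists x, d x = tau.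
Proof.
pose A (y : nat -> bool) (n : nat) := [set a : seq nat | y (choice.pickle (n, a))].
pose p (y : nat -> bool) (n : nat) := xget 0%N [set m : nat | y (choice.pickle (n, m))].
pose code (b c : bool) (y : nat -> bool) n :=
  if n is n'.+1 then if n' is n''.+1 then y n'' else c else b.
exists (fun x => let y := fun n => x n.+2 in
  if x 0%N then FilterCovers (A y)
  else if x 1%N then PositiveCovers (A y) else Split (p y)).
have Aex B : exists y, A y = B.
  exists (fun c => if choice.unpickle c is Some (n, a) then `[< B n a >] else false).
  apply/funext => n; apply/seteqP; split=> a; rewrite /A /= choice.pickleK.
    by move/asboolP.
  by move=> Ba; apply/asboolP.
case=> [B|B|phi].
- by have [y <-] := Aex B; exists (code true true y).
- by have [y <-] := Aex B; exists (code false true y).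
- exists (code false false (fun c =>
    if choice.unpickle c is Some (n, m) then phi n == m else false)) => /=.
  congr Split; apply/funext => n; apply: xget_unique => /=.
    by rewrite choice.pickleK.
  by move=> m; rewrite choice.pickleK => /eqP.
Qed.

Lemma compatible_eq {T : Type} (K L K' L' : T -> set cantor_space) (S : set T) :
  (forall j, S j -> K' j = K j /\ L' j = L j) ->
  compatible K L S -> compatible K' L' S.
Proof.
move=> eqS compS t u F H St Su.
rewrite (@finite_meets_eq _ K' K S)//; last by move=> j /eqS[].
move=> tF uH; apply: (compS t u) => //.
by case: u Su uH => //= j u [/eqS[_ ->]].
Qed.

Lemma seqs_max {T : Type} (lt : T -> T -> Prop) (S : set T) t :
  well_ordered lt -> seqs S t ->
  t = [::] \/ exists2 j, S j & seqs (seg lt j `|` [set j]) t.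
Proof.
move=> wo; elim: t => [|j t IH] /=; first by left.
move=> [Sj /IH[->|[k Sk kt]]]; right; first by exists j => //; split => //; right.
have [jk|jk|kj] := wo_total wo j k.
- by exists k => //; split => //; left.
- by exists k => //; split => //; right.
- exists j => //; split; first by right.
  apply: seqs_sub kt => l /= [lk|->]; left => //.
  exact: (wo_trans wo) kj.
Qed.

(** Compatibility concerns finitely many indices at a time, and these lie in the closed initial
    segment of the largest one. *)
Lemma compatible_union {T : Type} (lt : T -> T -> Prop)
    (K L : T -> set cantor_space) (S : set T) :
  well_ordered lt ->
  (forall j, S j -> compatible K L (seg lt j `|` [set j])) -> compatible K L S.
Proof.
move=> wo comp t u F H St Su tF uH m.
case: (seqs_max wo (seqs_cat St Su)) => [|[j Sj]].
  case: t u {St Su} tF uH => [|//] [|//] /= -> -> _.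
  by exists m.
move=> tuj; have [tj uj] : seqs (seg lt j `|` [set j]) t /\
    seqs (seg lt j `|` [set j]) u.
  elim: t {St tF} tuj => [|l t IH] //= [? /IH[? ?]]; split => //.
exact: comp Sj t u F H tj uj tF uH m.
Qed.

Lemma tower_exists
    (r_eq_c : min_card reaping continuum)
    (d_eq_c : min_card dominating continuum) :
  exists (K L : (nat -> bool) -> set cantor_space) (D : set (nat -> bool)),
    compatible K L D /\
    forall tau, exists2 i, D i & handled tau (K i) (L i).
Proof.
have [lt wo /card_le_ex[iota iotaD iotainj]] := small_initial_segments.
set D := [set i | _] in iotaD.
have [d dsurj] := task_code.
(* Inverting the injection [iota] before decoding makes every task occur at some stage in [D]. *)
pose e (i : nat -> bool) := d (xget point [set x | iota x = i]).
pose P i (f : (nat -> bool) -> set cantor_space * set cantor_space)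
    (p : set cantor_space * set cantor_space) :=
  [/\ compact p.1, compact p.2,
    extends (fst \o f) (snd \o f) (seg lt i) p.1 p.2 & handled (e i) p.1 p.2].
(* The selection is made for arbitrary [q] and is meaningful only if a solution exists; [main] shows
   by induction that one does at each stage in [D]. *)
have /choice[F FP] : forall q : (nat -> bool) *
    ((nat -> bool) -> set cantor_space * set cantor_space),
    exists p, (exists p, P q.1 q.2 p) -> P q.1 q.2 p.
  move=> q; have [[p Pp]|Np] := pselect (exists p, P q.1 q.2 p).
    by exists p.
  by exists (set0, set0) => /Np.
have [h hE] := wf_rec (set0 : set cantor_space, set0 : set cantor_space)
  (wo_wf wo) (fun i f => F (i, f)).
pose K := fst \o h; pose L := snd \o h.
have main i : D i -> [/\ compatible K L (seg lt i `|` [set i]),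
    compact (K i), compact (L i) & handled (e i) (K i) (L i)].
  elim: (wo_wf wo i) => {}i _ IH Di.
  have segD j : lt j i -> D j.
    move=> ji Nj; apply: Di; apply: card_le_trans Nj _.
    by apply: subset_card_le => k kj; exact: (wo_trans wo) ji.
  have comp_i : compatible K L (seg lt i).
    by apply: (compatible_union wo) => j ji; have [] := IH j ji (segD j ji).
  set f := (fun y => if pselect (lt y i) then h y else (set0, set0)).
  have fE j : seg lt i j -> f j = h j by rewrite /f; case: pselect.
  have [|p1 p2 p3 p4] := FP (i, f).
    have [|j ji|g|E Einf|Ki [Li [? ? ? ?]]] := @task_step _ (fst \o f) (snd \o f)
        (seg lt i) (e i).
    - by apply: compatible_eq comp_i => j /fE ji; rewrite /= ji.
    - by rewrite /= fE//; have [] := IH j ji (segD j ji).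
    - have [f' f'P] := not_dominating_family g d_eq_c (small_seqs wo Di).
      by exists f' => p /f'P/not_eventually_leP.
    - exact: not_reaping_family r_eq_c (small_seqs wo Di) Einf.
    - by exists (Ki, Li).
  have hi : h i = F (i, f) by rewrite hE.
  split; rewrite /K /L /= ?hi//.
  by apply: extends_compatible p3 _ _ _; rewrite /= ?hi// => j /fE ->.
exists K, L, D; split.
  by apply: (compatible_union wo) => j /main[].
move=> tau; have [x <-] := dsurj tau.
exists (iota x); first exact: iotaD.
have [_ _ _] := main _ (iotaD x Logic.I); congr (handled (d _) _ _).
apply: xget_unique => // y /= yx; apply: iotainj; rewrite ?inE//.
Qed.

(** * The filter *)

Lemma char_funK (Z : nat -> bool) : char_fun [set k | Z k] = Z.
Proof. by apply/funext => k; exact: asboolb. Qed.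

(** If [X] includes no bounded element of any [A n], its complement belongs to [hitting A f]; so it
    is enough to keep the complements of such sets out of [F]. *)
Lemma menger_by_bounds (F : set (set nat)) : upward_closed F ->
  (forall A : nat -> set (seq nat),
    (forall n (Z : nat -> bool), F [set k | Z k] -> hits (A n) Z) ->
    exists f, forall Z, hitting A f Z -> ~ F (~` [set k | Z k])) ->
  menger_family F.
Proof.
move=> Fup FA; apply: menger_upward => // A Ahits.
have [n Z FZ|f fP] := FA A; first by rewrite -(char_funK Z); exact: Ahits.
exists f => X FX; apply: contrapT => NX.
apply: (fP (fun k => ~~ char_fun X k)) => [n a Aa af|].
  rewrite has_predC; apply/negP => aX; apply: NX; exists n; exists a => //.
apply: Fup FX _ => k Xk /= /negP; apply; exact/asboolP.
Qed.

Theorem theorem2p4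
  (r_eq_c : min_card reaping continuum)
  (d_eq_c : min_card dominating continuum) :
  exists G : set_system nat,
    [/\ free_filter G,
        menger_family G /\ menger_family (positive G) &
        forall phi : nat -> nat,
          finite_to_one phi -> set_surj setT setT phi ->
          exists X : set nat,
            positive G (phi @^-1` X) /\ positive G (phi @^-1` (~` X))].
Proof.
have [K [L [D [comp tasks]]]] := tower_exists r_eq_c d_eq_c.
pose G : set_system nat := [set X | generated K D (char_fun X)].
have Gup : upward_closed G.
  move=> X Y [t [F [m [Dt tF FX]]]] XY; exists t, F, m; split=> // x mx Fx.
  by apply/asboolP/XY/asboolP; exact: FX.
have GK i Z : D i -> K i Z -> G [set k | Z k].
  move=> Di KZ; rewrite /G /= char_funK.
  exists [:: i], (meetc Z topc), 0%N; split => //=.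
    by exists Z => //; exists topc.
  by move=> x _ /andP[].
have posL i Z : D i -> L i Z -> positive G [set k | Z k].
  move=> Di LZ X [t [F [m [Dt tF FX]]]].
  have [x [mx Fx Zx]] := comp t [:: i] F Z Dt (conj Di Logic.I) tF LZ m.
  by exists x; split => //; apply/asboolP; exact: FX.
have posup : upward_closed (positive G).
  by move=> X Y posX XY F /posX[x [/XY Yx Fx]]; exists x.
exists G; split.
- split.
  + split.
    * by exists [::], topc, 0%N; split => // x _ _; apply/asboolP.
    * move=> X Y GX GY; have := generated_meetc GX GY.
      rewrite /G /=; congr (generated _ _ _); apply/funext => k.
      by rewrite /meetc /char_fun -asbool_and.
    * by move=> X Y XY GX; exact: Gup GX XY.
  + move=> X [t [F [m [Dt tF FX]]]]; apply/infinite_set_unbounded => n.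
    have [x [+ Fx _]] := comp t [::] F topc Dt Logic.I tF erefl (maxn m n).
    rewrite geq_max => /andP[mx nx]; exists x => //.
    by apply/asboolP; exact: FX.
  + move=> X /finite_set_bounded[m mX]; exists [::], topc, m; split => // x mx _.
    by apply/asboolP; apply: contrapT => /mX; rewrite ltnNge mx.
(* By [Ahits] only the second alternative of [handled] remains: sets in [hitting A f] are positive
   (resp. in [G]), so their complements are not in [G] (resp. not positive). *)
- split; apply: menger_by_bounds => // A Ahits.
  + have [i Di [[n [Z [KZ]]]|[f fL]]] := tasks (FilterCovers A).
      by case; apply: Ahits; exact: GK KZ.
    exists f => Z /fL LZ GZ.
    by have [x []] := posL i Z Di LZ _ GZ.
  + have [i Di [[n [Z [LZ]]]|[f fK]]] := tasks (PositiveCovers A).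
      by case; apply: Ahits; exact: posL LZ.
    exists f => Z /fK KZ posZ.
    by have [x []] := posZ _ (GK i Z Di KZ).
- move=> phi phifin _.
  have [i Di /(_ phifin) [X [LX LNX]]] := tasks (Split phi).
  exists [set k | X k]; split; first exact: posL LX.
  by apply: posup (posL _ _ Di LNX) _ => k /= /negP.
Qed.
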